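(* Let $n,m\in\mathbb N$ and let $\mathbf a\in M_m(\widehat M_n)$ be a block-diagonal matrix $\mathbf a=a_1\oplus\dots\oplus a_m$ with $a_k\in M_n$ for $k=1,\dots,m$ (i.e. the $m\times m$ matrix over $M_n$ with diagonal entries $a_1,\dots,a_m$ and zero off-diagonal entries). Then $$\|\mathbf a\|_m\ \ge\ \frac1n\sum_{k=1}^m\|a_k\|_t .$$
   Context: All linear spaces are complex. $M_n$ is the linear space of $n\times n$ complex matrices; $\|\cdot\|_o$ and $\|\cdot\|_t$ are the operator norm and the trace (trace class) norm on it. For a linear space $E$, $M_n(E)$ is the space of $n\times n$ matrices with entries in $E$; $u\oplus w$ denotes the block-diagonal matrix with blocks $u,w$. The closed unit ball of a normed space $X$ is $B_X$. A matrix-norm on $E$ is a sequence of norms $\|\cdot\|_n$ on $M_n(E)$, $n\in\mathbb N$, such that (Axiom 1) $\|u\oplus 0\|_{n+m}=\|u\|_n$ for $u\in M_n(E)$ and $0\in M_m(E)$; (Axiom 2) $\|Su\|_n\le\|S\|_o\|u\|_n$ and $\|uS\|_n\le\|u\|_n\|S\|_o$ for $u\in M_n(E)$, $S\in M_n$. A matricially normed space is a linear space with a matrix-norm. For a linear operator $\varphi:E\to F$, its $m$-th amplification is $\varphi_m:M_m(E)\to M_m(F)$, $(x_{ij})\mapsto(\varphi(x_{ij}))$. The space $\widehat M_n$: for a linear space $E$ and $v=(x_{ij})\in M_n(E)$ let $\varphi^v:M_n\to E$, $(\lambda_{ij})\mapsto\sum_{i,j}\lambda_{ji}x_{ij}$.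 $\widehat M_n$ is $M_n$ with the matrix-norm given on $u\in M_m(M_n)$ by $\|u\|_m:=\sup\|(\varphi^v)_m(u)\|_m$, the supremum taken over all pairs $(E,v)$ with $E$ a matricially normed space and $v\in B_{M_n(E)}$. *)

(* Defs.v *)
From HB Require Import structures.
From mathcomp Require Import all_boot all_order all_algebra.
From mathcomp Require Import spectral complex.
From mathcomp Require Import classical_sets reals.

Set Implicit Arguments.
Unset Strict Implicit.
Unset Printing Implicit Defensive.

Import Order.TTheory GRing.Theory Num.Theory.

Local Open Scope classical_set_scope.
Local Open Scope ring_scope.
Local Open Scope sesquilinear_scope.

Section ScalarMatrices.
Variable R : realType.
Local Notation C := R[i].

Definition vnorm n (x : 'cV[C]_n) : R :=
  Num.sqrt (\sum_(i < n) Normc.normc (x i ord0) ^+ 2).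

Definition opnorm n (S : 'M[C]_n) : R :=
  sup [set vnorm (S *m x) | x in [set x : 'cV[C]_n | vnorm x <= 1]].

(* [absmx A] is the positive square root of [A ^t* *m A], obtained by taking
   square roots of the eigenvalues in a unitary diagonalization. *)
Definition absmx n (A : 'M[C]_n) : 'M[C]_n :=
  let B := A ^t* *m A in
  invmx (spectralmx B) *m diag_mx (map_mx sqrtC (spectral_diag B))
    *m spectralmx B.

Definition trnorm n (A : 'M[C]_n) : R := complex.Re (\tr (absmx A)).

End ScalarMatrices.

Section MatrixNorms.
Variable R : realType.
Local Notation C := R[i].

Definition lmulmx (E : lmodType C) n (S : 'M[C]_n) (u : 'M[E]_n) : 'M[E]_n :=
  \matrix_(i, j) \sum_(k < n) S i k *: u k j.

Definition rmulmx (E : lmodType C) n (u : 'M[E]_n) (S : 'M[C]_n) : 'M[E]_n :=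
  \matrix_(i, j) \sum_(k < n) S k j *: u i k.

(* Entries of ['M[E]_n] are scaled with [map_mx] because MathComp has no scaling
   on matrices over a module.  The index [n = 0] is harmless: ['M[E]_0] is
   trivial, so every norm there is 0 and the axioms hold at it for free. *)
Record matNormedSpace := MatNormedSpace {
  mns_sort :> lmodType C;
  mnorm : forall n, 'M[mns_sort]_n -> R;
  mnorm_triangle : forall n (u w : 'M[mns_sort]_n),
    mnorm (u + w) <= mnorm u + mnorm w;
  mnorm_scale : forall n (c : C) (u : 'M[mns_sort]_n),
    mnorm (map_mx ( *:%R c) u) = Normc.normc c * mnorm u;
  mnorm_eq0 : forall n (u : 'M[mns_sort]_n), mnorm u = 0 -> u = 0;
  mnorm_block0 : forall n m (u : 'M[mns_sort]_n),
    mnorm (block_mx u 0 0 (0 : 'M[mns_sort]_m)) = mnorm u;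
  mnorm_lmul : forall n (S : 'M[C]_n) (u : 'M[mns_sort]_n),
    mnorm (lmulmx S u) <= opnorm S * mnorm u;
  mnorm_rmul : forall n (u : 'M[mns_sort]_n) (S : 'M[C]_n),
    mnorm (rmulmx u S) <= mnorm u * opnorm S
}.

(* The operator M_n -> E attached to [v]; note the transposed index in [l]. *)
Definition phi (E : lmodType C) n (v : 'M[E]_n) (l : 'M[C]_n) : E :=
  \sum_(i < n) \sum_(j < n) l j i *: v i j.

Definition amplification (E F : Type) m (f : E -> F) (u : 'M[E]_m) : 'M[F]_m :=
  map_mx f u.

(* The m-th norm of the space \widehat{M}_n.  The supremum is a real one: the
   set is nonempty and bounded above, by the sum of the moduli of all the
   scalar entries of [u]. *)
Definition hatnorm n m (u : 'M['M[C]_n]_m) : R :=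
  sup [set r : R | exists (E : matNormedSpace) (v : 'M[E]_n),
         mnorm v <= 1 /\ r = mnorm (amplification (phi v) u)].

End MatrixNorms.

(* Main.v *)
(** Take for [E] the space M_n with the trace norm of M_k (x) M_n on M_k(E).
    With [v := n^-1 * (e_ij)_ij], a multiple by 1/n of a rank one operator of
    trace norm n, one has [mnorm v <= 1], and [phi v] is 1/n times the
    transposition, so that a block-diagonal matrix goes to one of trace norm
    [n^-1 * \sum_k trnorm (a k)].  The trace norm enters as the dual of the
    operator norm, which makes it subadditive at once; the lower bound on the
    block-diagonal matrix comes from pairing each block with the contraction of
    its polar decomposition. *)

Require Import Defs.
From HB Require Import structures.
From mathcomp Require Import all_boot all_order all_algebra.
From mathcomp Require Import spectral complex.
From mathcomp Require Import classical_sets reals.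
From mathcomp Require Import ring.

Set Implicit Arguments.
Unset Strict Implicit.
Unset Printing Implicit Defensive.

Import Order.TTheory GRing.Theory Num.Theory.
Local Open Scope complex_scope.
Local Open Scope classical_set_scope.
Local Open Scope ring_scope.

(** * Moduli of complex numbers and Euclidean norms of finite families *)

Section EuclideanNorm.
Variable R : realType.
Local Notation C := R[i].
Local Notation normc := (@Normc.normc R).

Lemma normcD (x y : C) : normc (x + y) <= normc x + normc y.
Proof. exact: le_normcD. Qed.

Lemma normc_ge0 (x : C) : 0 <= normc x.
Proof. by case: x => a b; apply: sqrtr_ge0. Qed.

Lemma normc_conj (x : C) : normc (x^*) = normc x.
Proof. by case: x => a b /=; rewrite sqrrN. Qed.

Lemma Re_le_normc (x : C) : complex.Re x <= normc x.
Proof.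
case: x => a b /=; apply: le_trans (ler_norm a) _.
by rewrite -sqrtr_sqr ler_wsqrtr // lerDl sqr_ge0.
Qed.

Lemma mul_conj_normc (x : C) : x * x^* = (normc x ^+ 2)%:C.
Proof. by rewrite -normCK rmorphXn; case: x. Qed.

Lemma normc_real (x : R) : 0 <= x -> normc (x%:C) = x.
Proof. by move=> x0 /=; rewrite expr0n /= addr0 sqrtr_sqr ger0_norm. Qed.

Lemma normc_sum (I : Type) (r : seq I) (P : pred I) (F : I -> C) :
  normc (\sum_(i <- r | P i) F i) <= \sum_(i <- r | P i) normc (F i).
Proof.
elim/big_rec2: _ => [|i a b _ IH]; first by rewrite Normc.normc0.
by apply: le_trans (normcD _ _) _; rewrite lerD2l.
Qed.

(** Indexed by any finite type, so that columns, rows and whole k x n matrices share the same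
    lemmas. *)
Definition l2 (I : finType) (f : I -> C) : R :=
  Num.sqrt (\sum_i normc (f i) ^+ 2).

Lemma eq_l2 (I : finType) (f g : I -> C) : f =1 g -> l2 f = l2 g.
Proof. by move=> fg; congr Num.sqrt; apply: eq_bigr => i _; rewrite fg. Qed.

Lemma l2_ge0 (I : finType) (f : I -> C) : 0 <= l2 f.
Proof. exact: sqrtr_ge0. Qed.

Lemma sqr_l2 (I : finType) (f : I -> C) :
  l2 f ^+ 2 = \sum_i normc (f i) ^+ 2.
Proof. by rewrite sqr_sqrtr // sumr_ge0 // => i _; rewrite sqr_ge0. Qed.

Lemma le_l2_sqr (I J : finType) (f : I -> C) (g : J -> C) c : 0 <= c ->
  (l2 f <= c * l2 g) = (l2 f ^+ 2 <= c ^+ 2 * l2 g ^+ 2).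
Proof.
by move=> c0; rewrite -exprMn ler_pXn2r ?nnegrE ?mulr_ge0 ?l2_ge0.
Qed.

Lemma normc_le_l2 (I : finType) (f : I -> C) i : normc (f i) <= l2 f.
Proof.
rewrite -(@ler_pXn2r _ 2) ?nnegrE ?normc_ge0 ?l2_ge0 // sqr_l2 (bigD1 i) //=.
by rewrite lerDl sumr_ge0 // => j _; rewrite sqr_ge0.
Qed.

Lemma l2_le_sum (I : finType) (f : I -> C) : l2 f <= \sum_i normc (f i).
Proof.
rewrite -(@ler_pXn2r _ 2) ?nnegrE ?l2_ge0 ?sumr_ge0 // => [|i _];
  last exact: normc_ge0.
rewrite sqr_l2 [leRHS]expr2 mulr_suml ler_sum // => i _.
rewrite expr2 ler_wpM2l ?normc_ge0 // (bigD1 i) //=.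
by rewrite lerDl sumr_ge0 // => j _; rewrite normc_ge0.
Qed.

Lemma l2_delta (I : finType) (i : I) : l2 (fun j => (j == i)%:R) = 1.
Proof.
rewrite /l2 (bigD1 i) //= eqxx Normc.normc1 big1 ?addr0 ?expr1n ?sqrtr1 // => j.
by move=> /negPf ->; rewrite Normc.normc0 expr0n.
Qed.

(** Lagrange's identity: twice the defect in the Cauchy-Schwarz inequality is the double sum of the
    squares of [a i * b j - a j * b i]. *)
Lemma sqr_sum_mul_le (I : finType) (a b : I -> R) :
  (\sum_i a i * b i) ^+ 2 <= (\sum_i a i ^+ 2) * (\sum_i b i ^+ 2).
Proof.
have : 0 <= \sum_i \sum_j (a i * b j - a j * b i) ^+ 2.
  by apply: sumr_ge0 => i _; apply: sumr_ge0 => j _; apply: sqr_ge0.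
suff -> : \sum_i \sum_j (a i * b j - a j * b i) ^+ 2
    = 2 * ((\sum_i a i ^+ 2) * (\sum_i b i ^+ 2) - (\sum_i a i * b i) ^+ 2).
  by rewrite pmulr_rge0 // subr_ge0.
transitivity (\sum_i \sum_j (a i ^+ 2 * b j ^+ 2 + b i ^+ 2 * a j ^+ 2
    + (- 2 * (a i * b i)) * (a j * b j))).
  by apply: eq_bigr => i _; apply: eq_bigr => j _; ring.
under eq_bigr => i _ do rewrite !big_split /= -!mulr_sumr.
by rewrite !big_split /= -!mulr_suml -mulr_sumr; ring.
Qed.

Lemma normc_sum_mul_le (I : finType) (f g : I -> C) :
  normc (\sum_i f i * g i) <= l2 f * l2 g.
Proof.
apply: le_trans (normc_sum _ _ _) _.
under eq_bigr => i _ do rewrite Normc.normcM.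
rewrite -(@ler_pXn2r _ 2) ?nnegrE ?mulr_ge0 ?l2_ge0 //; last first.
  by apply: sumr_ge0 => i _; rewrite mulr_ge0 ?normc_ge0.
by rewrite exprMn !sqr_l2 sqr_sum_mul_le.
Qed.

Lemma l2Z (I : finType) (c : C) (f : I -> C) :
  l2 (fun i => c * f i) = normc c * l2 f.
Proof.
rewrite /l2; under eq_bigr => i _ do rewrite Normc.normcM exprMn.
by rewrite -mulr_sumr sqrtrM ?sqr_ge0 // sqrtr_sqr ger0_norm ?normc_ge0.
Qed.

Lemma l2_eq0 (I : finType) (f : I -> C) i : l2 f = 0 -> f i = 0.
Proof.
move=> f0; apply: Normc.eq0_normc; apply/le_anti.
by rewrite normc_ge0 -f0 normc_le_l2.
Qed.

Lemma l2_conj (I : finType) (f : I -> C) : l2 (fun i => (f i)^*) = l2 f.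
Proof. by congr Num.sqrt; apply: eq_bigr => i _; rewrite normc_conj. Qed.

End EuclideanNorm.

(** * The operator norm of scalar matrices and the Frobenius norm *)

Section OperatorNorm.
Variable R : realType.
Local Notation C := R[i].
Local Notation normc := (@Normc.normc R).

Lemma vnormE n (x : 'cV[C]_n) : vnorm x = l2 (fun i => x i ord0).
Proof. by []. Qed.

Lemma vnorm0 n : vnorm (0 : 'cV[C]_n) = 0.
Proof.
by rewrite /vnorm big1 ?sqrtr0 // => i _; rewrite mxE Normc.normc0 expr0n.
Qed.

Lemma vnormZ n (c : C) (x : 'cV[C]_n) : vnorm (c *: x) = normc c * vnorm x.
Proof. by rewrite !vnormE -l2Z; apply: eq_l2 => i; rewrite mxE. Qed.

(** Each coordinate of a vector of the unit ball has modulus at most 1. A real [sup] dominates its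
    set only once such a bound is known. *)
Lemma opnorm_set_bounded n (S : 'M[C]_n) :
  has_ubound [set vnorm (S *m x) | x in [set x : 'cV[C]_n | vnorm x <= 1]].
Proof.
exists (\sum_i \sum_j normc (S i j)) => _ [x /= x1 <-].
apply: le_trans (l2_le_sum _) _; apply: ler_sum => i _.
rewrite mxE; apply: le_trans (normc_sum _ _ _) _; apply: ler_sum => j _.
rewrite Normc.normcM ler_piMr ?normc_ge0 //.
by apply: le_trans x1; apply: (normc_le_l2 (fun j => x j ord0)).
Qed.

Lemma vnorm_mul_le_opnorm n (S : 'M[C]_n) (x : 'cV[C]_n) :
  vnorm x <= 1 -> vnorm (S *m x) <= opnorm S.
Proof.
move=> x1; apply: (ub_le_sup (opnorm_set_bounded S)); by exists x.
Qed.

Lemma opnorm_ge0 n (S : 'M[C]_n) : 0 <= opnorm S.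
Proof.
apply: le_trans (vnorm_mul_le_opnorm S (x := 0) _).
  exact: l2_ge0.
by rewrite vnorm0 ler01.
Qed.

Lemma opnorm_le n (S : 'M[C]_n) c :
  (forall x : 'cV[C]_n, vnorm x <= 1 -> vnorm (S *m x) <= c) -> opnorm S <= c.
Proof.
move=> Sc; apply: ge_sup => [|_ [x x1 <-]]; last exact: Sc.
by exists (vnorm (S *m 0)), 0 => //=; rewrite vnorm0 ler01.
Qed.

Lemma vnorm_mul n (S : 'M[C]_n) (x : 'cV[C]_n) :
  vnorm (S *m x) <= opnorm S * vnorm x.
Proof.
have [x0|xn0] := eqVneq (vnorm x) 0.
  have -> : x = 0.
    apply/matrixP => i j; rewrite ord1 mxE.
    exact: (l2_eq0 (f := fun i => x i ord0) i x0).
  by rewrite mulmx0 !vnorm0 mulr0.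
have xgt0 : 0 < vnorm x by rewrite lt_def xn0 l2_ge0.
rewrite -ler_pdivrMr // mulrC.
have inv : normc ((vnorm x)^-1)%:C = (vnorm x)^-1.
  by rewrite normc_real // invr_ge0 ltW.
rewrite -inv -vnormZ scalemxAr; apply: vnorm_mul_le_opnorm.
by rewrite vnormZ inv mulVf.
Qed.

(* Duality: |S^T x|^2 = x^T S conj(S^T x). *)
Lemma vnorm_mul_tr n (S : 'M[C]_n) (x : 'cV[C]_n) :
  vnorm (S^T *m x) <= opnorm S * vnorm x.
Proof.
set y := S^T *m x; pose z : 'cV[C]_n := map_mx Num.conj y.
have zy : vnorm z = vnorm y.
  rewrite !vnormE -[RHS]l2_conj; apply: eq_l2 => i; by rewrite mxE.
have y2 : (vnorm y ^+ 2)%:C = \sum_i x i ord0 * (S *m z) i ord0.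
  rewrite sqr_l2 rmorph_sum /=.
  under eq_bigr => i _ do rewrite -mul_conj_normc {1}mxE mulr_suml.
  rewrite exchange_big /=; apply: eq_bigr => i _.
  rewrite mxE mulr_sumr; apply: eq_bigr => j _.
  by rewrite !mxE; ring.
have le2 : vnorm y ^+ 2 <= vnorm x * (opnorm S * vnorm y).
  rewrite -[leLHS]normc_real ?sqr_ge0 // y2 -zy.
  apply: le_trans (normc_sum_mul_le _ _) _.
  by apply: ler_wpM2l; [exact: l2_ge0|exact: vnorm_mul].
have [->|yn0] := eqVneq (vnorm y) 0.
  by rewrite mulr_ge0 ?opnorm_ge0 ?l2_ge0.
have ygt0 : 0 < vnorm y by rewrite lt_def yn0 l2_ge0.
by rewrite -(ler_pM2r ygt0) -expr2 (le_trans le2) // mulrCA mulrA.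
Qed.

(** Through Axiom 2, this lets matrix units move entries around without increasing a matrix-norm. *)
Lemma opnorm_delta n (p q : 'I_n) : opnorm (delta_mx p q : 'M[C]_n) <= 1.
Proof.
apply: opnorm_le => x x1; apply: le_trans x1.
rewrite vnormE.
have -> : l2 (fun i => (delta_mx p q *m x) i ord0) =
    l2 (fun i => x q ord0 * (i == p)%:R).
  apply: eq_l2 => i; rewrite mxE (bigD1 q) //= mxE eqxx andbT big1 ?addr0.
    by rewrite mulrC.
  by move=> j /negPf jq; rewrite mxE jq andbF mul0r.
by rewrite l2Z l2_delta mulr1 (normc_le_l2 (fun i => x i ord0)).
Qed.

(** The Hilbert space norm of C^k (x) C^n, on which left multiplication by [S] is the operator S (x)
    1. *)
Definition frob k n (y : 'M[C]_(k, n)) : R :=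
  l2 (fun s : 'I_k * 'I_n => y s.1 s.2).

Lemma frobE k n (y : 'M[C]_(k, n)) :
  frob y ^+ 2 = \sum_j vnorm (col j y) ^+ 2.
Proof.
rewrite sqr_l2 -(pair_bigA _ (fun i j => normc (y i j) ^+ 2)) exchange_big /=.
apply: eq_bigr => j _; rewrite sqr_l2; apply: eq_bigr => i _.
by rewrite mxE.
Qed.

Lemma frob_row k n (y : 'M[C]_(k, n)) :
  frob y ^+ 2 = \sum_i l2 (y i) ^+ 2.
Proof.
rewrite sqr_l2 -(pair_bigA _ (fun i j => normc (y i j) ^+ 2)) /=.
by apply: eq_bigr => i _; rewrite sqr_l2.
Qed.

(** [S] acts on each column separately, and the squared Frobenius norm is the sum of the squared
    norms of the columns. *)
Lemma le_frob k n (S : 'M[C]_k) (c : R) (y : 'M[C]_(k, n)) : 0 <= c ->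
    (forall x : 'cV[C]_k, vnorm (S *m x) <= c * vnorm x) ->
  frob (S *m y) <= c * frob y.
Proof.
move=> c0 Sc; rewrite le_l2_sqr // -/(frob y) -/(frob (S *m y)) !frobE mulr_sumr.
apply: ler_sum => j _; rewrite colE -mulmxA -colE -le_l2_sqr //; exact: Sc.
Qed.

Lemma frob_mul k n (S : 'M[C]_k) (y : 'M[C]_(k, n)) :
  frob (S *m y) <= opnorm S * frob y.
Proof. by apply: le_frob => [|x]; [exact: opnorm_ge0 | exact: vnorm_mul]. Qed.

Lemma frob_mul_tr k n (S : 'M[C]_k) (y : 'M[C]_(k, n)) :
  frob (S^T *m y) <= opnorm S * frob y.
Proof. by apply: le_frob => [|x]; [exact: opnorm_ge0 | exact: vnorm_mul_tr]. Qed.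

Lemma frob1 n : frob (1%:M : 'M[C]_n) ^+ 2 = n%:R.
Proof.
rewrite frob_row (eq_bigr (fun=> 1)) ?sumr_const ?card_ord // => i _.
rewrite (@eq_l2 _ _ _ (fun j => (j == i)%:R)) ?l2_delta ?expr1n // => j.
by rewrite mxE eq_sym.
Qed.

Lemma frob_delta k n (p : 'I_k) (q : 'I_n) : frob (delta_mx p q : 'M[C]_(k, n)) = 1.
Proof.
rewrite -[RHS](l2_delta _ (p, q)); apply: eq_l2 => -[i j] /=.
by rewrite mxE xpair_eqE.
Qed.

Lemma frob_col_mx0 k l n (y : 'M[C]_(k, n)) :
  frob (col_mx y 0 : 'M[C]_(k + l, n)) = frob y.
Proof.
apply/eqP; rewrite -(@eqrXn2 _ 2) ?l2_ge0 // !frob_row big_split_ord /=.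
rewrite [X in _ + X]big1 ?addr0 => [|i _].
  apply/eqP; apply: eq_bigr => i _; congr (_ ^+ 2); apply: eq_l2 => j.
  by rewrite col_mxEu.
rewrite sqr_l2 big1 // => j _; by rewrite col_mxEd mxE Normc.normc0 expr0n.
Qed.

Lemma frob_usubmx k l n (y : 'M[C]_(k + l, n)) : frob (usubmx y) <= frob y.
Proof.
rewrite -(@ler_pXn2r _ 2) ?nnegrE ?l2_ge0 // !frob_row [leRHS]big_split_ord /=.
rewrite (eq_bigr (fun i => l2 (y (lshift l i)) ^+ 2)) => [|i _].
  by rewrite lerDl sumr_ge0 // => i _; rewrite sqr_ge0.
by congr (_ ^+ 2); apply: eq_l2 => j; rewrite mxE.
Qed.

End OperatorNorm.

(** * Polar decomposition of a square matrix *)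

Section PolarDecomposition.
Variable R : realType.
Local Notation C := R[i].
Local Notation normc := (@Normc.normc R).
Local Open Scope sesquilinear_scope.

Lemma trmxC_mul m n p (A : 'M[C]_(m, n)) (B : 'M[C]_(n, p)) :
  (A *m B)^t* = B^t* *m A^t*.
Proof. by rewrite trmx_mul map_mxM. Qed.

Lemma sqr_l2_row n (w : 'rV[C]_n) : (l2 (w ord0) ^+ 2)%:C = (w *m w^t*) ord0 ord0.
Proof.
rewrite sqr_l2 rmorph_sum mxE /=; apply: eq_bigr => i _.
by rewrite !mxE -mul_conj_normc.
Qed.

(** In the unitary coordinates w = y P^t*, the squared norm of y V is the sum of the e_i |w_i|^2,
    and that of y is the sum of the |w_i|^2. *)
Lemma l2_mul_contraction n (V P : 'M[C]_n) (e : 'rV[C]_n) :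
    P \is unitarymx -> (forall i, e ord0 i <= 1) ->
    V *m V^t* = P^t* *m diag_mx e *m P ->
  forall y : 'rV[C]_n, l2 ((y *m V) ord0) <= l2 (y ord0).
Proof.
move=> Pu e1 VV y.
rewrite -(@ler_pXn2r _ 2) ?nnegrE ?l2_ge0 // -lecR !sqr_l2_row.
rewrite trmxC_mul mulmxA -(mulmxA y) VV.
have -> : y *m y^t* = (y *m P^t*) *m (y *m P^t*)^t*.
  rewrite trmxC_mul trmxCK mulmxA -(mulmxA y) -(invmx_unitary Pu) mulVmx ?mulmx1 //.
  exact: unitarymx_unit.
rewrite !mulmxA -[X in X <= _](_ : (y *m P^t* *m diag_mx e *m (y *m P^t*)^t*) ord0 ord0 = _);
  last by rewrite trmxC_mul trmxCK !mulmxA.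
move: (y *m P^t*) => w; rewrite !mxE; apply: ler_sum => i _.
rewrite mul_mx_diag !mxE mulrAC mul_conj_normc -[leRHS]mulr1.
by apply: ler_wpM2l => //; rewrite ler0c sqr_ge0.
Qed.

(** With B = A^t* A, take V = B^(-1/2) A^t*, the inverse being a pseudo-inverse. The contraction
    property is stated for the bilinear form of [V], which is how [contractive] tests a block. *)
Lemma polar_contraction n (A : 'M[C]_n) :
  exists2 V : 'M[C]_n, V *m A = absmx A &
    forall y x : 'I_n -> C,
      normc (\sum_i \sum_j V i j * (y i * x j)) <= l2 y * l2 x.
Proof.
pose B := A^t* *m A; pose P := spectralmx B; pose d := spectral_diag B.
have Pu : P \is unitarymx := spectral_unitarymx B.
have Bn : B \is normalmx.
  by apply/normalmxP; rewrite trmxC_mul trmxCK.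
have PP : P *m P^t* = 1%:M by apply/unitarymxP.
have BE : B = P^t* *m diag_mx d *m P.
  by rewrite -(invmx_unitary Pu); apply/orthomx_spectralP.
(* Each eigenvalue is a diagonal entry of Z Z^t* with Z = P A^t*, hence a sum of squared moduli. *)
have d_ge0 i : 0 <= d ord0 i.
  have -> : d ord0 i = ((P *m A^t*) *m (P *m A^t*)^t*) i i.
    have -> : (P *m A^t*) *m (P *m A^t*)^t* = P *m B *m P^t*.
      by rewrite trmxC_mul trmxCK !mulmxA.
    rewrite BE !mulmxA PP mul1mx -mulmxA PP mulmx1.
    by rewrite mxE eqxx.
  move: (P *m A^t*) => Z; rewrite mxE sumr_ge0 // => j _; rewrite !mxE.
  by rewrite mul_conj_normc ler0c sqr_ge0.
(* Since 0^-1 = 0, [s'] gives the pseudo-inverse of the square root even when [A] is singular. *)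
pose s := map_mx sqrtC d; pose s' : 'rV[C]_n := map_mx (fun z => z^-1) s.
have s'_conj : (diag_mx s')^t* = diag_mx s'.
  apply/matrixP => i j; rewrite !mxE eq_sym; case: eqVneq => [->|_]; last first.
    by rewrite !mulr0n conjC0.
  by rewrite !mulr1n conj_Creal // ger0_real // invr_ge0 sqrtC_ge0.
exists (P^t* *m diag_mx s' *m P *m A^t*).
  rewrite -[LHS]mulmxA -/B {1}BE !mulmxA -(mulmxA _ P) PP mulmx1 /absmx.
  rewrite -/B -/P (invmx_unitary Pu); congr (_ *m _).
  rewrite -mulmxA; congr (_ *m _).
  rewrite mulmx_diag; congr diag_mx; apply/rowP => i; rewrite !mxE.
  rewrite -{2}[spectral_diag B ord0 i]sqrtCK -/d expr2 mulrA.
  have [->|s0] := eqVneq (sqrtC (d ord0 i)) 0; first by rewrite mulr0.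
  by rewrite mulVf ?mul1r.
(* V V^t* is the orthogonal projection onto the range of [B]; [e] holds its eigenvalues 0 and 1. *)
set V := _ *m A^t*; pose e : 'rV[C]_n := \row_i (d ord0 i != 0)%:R.
have VV : V *m V^t* = P^t* *m diag_mx e *m P.
  rewrite /V !trmxC_mul !trmxCK s'_conj !mulmxA -(mulmxA _ (A^t*) A) -/B BE.
  rewrite !mulmxA -(mulmxA _ P (P^t*)) PP mulmx1 -(mulmxA _ P (P^t*)) PP mulmx1.
  congr (_ *m _); rewrite -!mulmxA; congr (_ *m _).
  rewrite !mulmx_diag; congr diag_mx; apply/rowP => i; rewrite !mxE.
  rewrite -{2}[d ord0 i]sqrtCK expr2 -[X in X != 0]sqrtCK sqrf_eq0.
  have [->|s0] := eqVneq (sqrtC (d ord0 i)) 0; first by rewrite !mul0r mulr0.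
  by rewrite mulfK // mulVf.
move=> y x; pose yr := \row_i y i.
have -> : \sum_i \sum_j V i j * (y i * x j) = \sum_j (yr *m V) ord0 j * x j.
  rewrite exchange_big; apply: eq_bigr => j _; rewrite mxE mulr_suml.
  by apply: eq_bigr => i _; rewrite [yr _ _]mxE mulrA (mulrC (y i)).
apply: le_trans (normc_sum_mul_le _ _) _; apply: ler_wpM2r; first exact: l2_ge0.
rewrite [leRHS](@eq_l2 _ _ _ (yr ord0)) => [|i]; last by rewrite mxE.
apply: l2_mul_contraction Pu _ VV _ => i; rewrite mxE lern1.
exact: leq_b1.
Qed.

End PolarDecomposition.

(** * The trace norm on M_k(M_n) as the dual of the operator norm *)

Section DualTraceNorm.
Variables (R : realType) (n : nat).
Local Notation C := R[i].
Local Notation normc := (@Normc.normc R).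
Local Notation E := 'M[C]_n.

(** A transpose instead of an adjoint keeps the pairing bilinear, so that no conjugates arise when
    scalar matrices cross it. *)
Definition ip (w u : E) : C := \tr (w *m u^T).

Lemma ipE (w u : E) : ip w u = \sum_i \sum_j w i j * u i j.
Proof.
apply: eq_bigr => i _; rewrite mxE; apply: eq_bigr => j _; by rewrite mxE.
Qed.

Lemma ip0l u : ip 0 u = 0.
Proof. by rewrite /ip mul0mx mxtrace0. Qed.

Lemma ip0r w : ip w 0 = 0.
Proof. by rewrite /ip trmx0 mulmx0 mxtrace0. Qed.

Lemma ipDr w u1 u2 : ip w (u1 + u2) = ip w u1 + ip w u2.
Proof. by rewrite /ip raddfD mulmxDr mxtraceD. Qed.

Lemma ipZl c w u : ip (c *: w) u = c * ip w u.
Proof. by rewrite /ip -scalemxAl mxtraceZ. Qed.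

Lemma ipZr c w u : ip w (c *: u) = c * ip w u.
Proof. by rewrite /ip linearZ -scalemxAr mxtraceZ. Qed.

Lemma ip_sumZl (I : finType) (c : I -> C) (w : I -> E) u :
  ip (\sum_i c i *: w i) u = \sum_i c i * ip (w i) u.
Proof.
rewrite /ip mulmx_suml raddf_sum; apply: eq_bigr => i _.
exact: ipZl.
Qed.

Lemma ip_sumZr (I : finType) (c : I -> C) (u : I -> E) w :
  ip w (\sum_i c i *: u i) = \sum_i c i * ip w (u i).
Proof.
rewrite /ip raddf_sum mulmx_sumr raddf_sum; apply: eq_bigr => i _.
exact: ipZr.
Qed.

Definition pairing k (W u : 'M[E]_k) : C := \sum_p \sum_q ip (W p q) (u p q).

(* The rank one operator [|y><x^*|] on C^k (x) C^n, the vectors of this space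
   being k x n matrices. *)
Definition tens k (y x : 'M[C]_(k, n)) : 'M[E]_k :=
  \matrix_(p, q) \matrix_(i, j) (y p i * x q j).

(** Operator norm at most 1 on C^k (x) C^n: [pairing W (tens y x)] is the bilinear form of [W] at
    [y] and [x]. Using it instead of the sesquilinear form changes nothing, as conjugation preserves
    [frob]. *)
Definition contractive k (W : 'M[E]_k) :=
  forall y x : 'M[C]_(k, n), normc (pairing W (tens y x)) <= frob y * frob x.

Definition dual_norm k (u : 'M[E]_k) : R :=
  sup [set normc (pairing W u) | W in [set W : 'M[E]_k | contractive W]].

Lemma pairing_lmul k S (W u : 'M[E]_k) :
  pairing W (lmulmx S u) = pairing (lmulmx S^T W) u.
Proof.
rewrite /pairing exchange_big [RHS]exchange_big /=; apply: eq_bigr => q _.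
transitivity (\sum_p \sum_r S p r * ip (W p q) (u r q)).
  by apply: eq_bigr => p _; rewrite mxE ip_sumZr.
rewrite exchange_big /=; apply: eq_bigr => r _.
rewrite mxE ip_sumZl; apply: eq_bigr => p _; by rewrite mxE.
Qed.

Lemma pairing_rmul k S (W u : 'M[E]_k) :
  pairing W (rmulmx u S) = pairing (rmulmx W S^T) u.
Proof.
apply: eq_bigr => p _.
transitivity (\sum_q \sum_r S r q * ip (W p q) (u p r)).
  by apply: eq_bigr => q _; rewrite mxE ip_sumZr.
rewrite exchange_big /=; apply: eq_bigr => r _.
rewrite mxE ip_sumZl; apply: eq_bigr => q _; by rewrite mxE.
Qed.

Lemma lmul_tens k S (y x : 'M[C]_(k, n)) : lmulmx S (tens y x) = tens (S *m y) x.
Proof.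
apply/matrixP => p q; apply/matrixP => i j.
rewrite !mxE summxE mulr_suml; apply: eq_bigr => r _.
by rewrite !mxE mulrA.
Qed.

Lemma rmul_tens k S (y x : 'M[C]_(k, n)) :
  rmulmx (tens y x) S = tens y (S^T *m x).
Proof.
apply/matrixP => p q; apply/matrixP => i j.
rewrite !mxE summxE mulr_sumr; apply: eq_bigr => r _.
by rewrite !mxE mulrCA.
Qed.

Lemma pairing_block0 k l (W : 'M[E]_(k + l)) (u : 'M[E]_k) :
  pairing W (block_mx u 0 0 0) = pairing (ulsubmx W) u.
Proof.
rewrite /pairing big_split_ord /= [X in _ + X]big1 ?addr0.
  apply: eq_bigr => p _; rewrite big_split_ord /= [X in _ + X]big1 ?addr0.
    by apply: eq_bigr => q _; rewrite block_mxEul !mxE.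
  by move=> q _; rewrite block_mxEur mxE ip0r.
move=> p _; rewrite big_split_ord /= !big1 ?addr0 // => q _.
  by rewrite block_mxEdr mxE ip0r.
by rewrite block_mxEdl mxE ip0r.
Qed.

Lemma block0_pairing k l (W : 'M[E]_k) (u : 'M[E]_(k + l)) :
  pairing (block_mx W 0 0 0) u = pairing W (ulsubmx u).
Proof.
rewrite /pairing big_split_ord /= [X in _ + X]big1 ?addr0.
  apply: eq_bigr => p _; rewrite big_split_ord /= [X in _ + X]big1 ?addr0.
    by apply: eq_bigr => q _; rewrite block_mxEul !mxE.
  by move=> q _; rewrite block_mxEur mxE ip0l.
move=> p _; rewrite big_split_ord /= !big1 ?addr0 // => q _.
  by rewrite block_mxEdr mxE ip0l.
by rewrite block_mxEdl mxE ip0l.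
Qed.

Lemma block_tens k l (y x : 'M[C]_(k, n)) :
  block_mx (tens y x) 0 0 (0 : 'M[E]_l) = tens (col_mx y 0) (col_mx x 0).
Proof.
apply/matrixP => p q; apply/matrixP => i j; rewrite ![in RHS]mxE.
by case: (split_ordP p) => p' ->; case: (split_ordP q) => q' ->;
  rewrite ?(block_mxEul, block_mxEur, block_mxEdl, block_mxEdr);
  rewrite ?(col_mxEu, col_mxEd) !mxE ?mul0r ?mulr0.
Qed.

Lemma ulsub_tens k l (y x : 'M[C]_(k + l, n)) :
  ulsubmx (tens y x) = tens (usubmx y) (usubmx x).
Proof. by apply/matrixP => p q; apply/matrixP => i j; rewrite !mxE. Qed.

(** Padding [y] and [x] with zeros preserves their norms and tests only the corner of [W]. *)
Lemma contractive_ulsub k l (W : 'M[E]_(k + l)) :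
  contractive W -> contractive (ulsubmx W).
Proof.
move=> Wc y x; rewrite -pairing_block0 block_tens.
by rewrite -(frob_col_mx0 l y) -(frob_col_mx0 l x).
Qed.

Lemma contractive_block0 k l (W : 'M[E]_k) :
  contractive W -> contractive (block_mx W 0 0 (0 : 'M[E]_l)).
Proof.
move=> Wc y x; rewrite block0_pairing ulsub_tens.
by apply: le_trans (Wc _ _) _; rewrite ler_pM ?l2_ge0 ?frob_usubmx.
Qed.

Lemma contractive0 k : contractive (0 : 'M[E]_k).
Proof.
move=> y x; rewrite /pairing big1 => [|p _]; last first.
  by rewrite big1 // => q _; rewrite mxE ip0l.
by rewrite Normc.normc0 mulr_ge0 ?l2_ge0.
Qed.

(** Each entry is the value of the form at two basis vectors. This bounds the set whose supremum is
    [dual_norm]. *)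
Lemma contractive_entry k (W : 'M[E]_k) p q i j :
  contractive W -> normc (W p q i j) <= 1.
Proof.
move=> /(_ (delta_mx p i) (delta_mx q j)); rewrite !frob_delta mulr1.
congr (normc _ <= _); rewrite /pairing (bigD1 p) //= (bigD1 q) //= ipE.
rewrite (bigD1 i) //= (bigD1 j) //= !mxE !eqxx !mulr1.
rewrite !big1 ?addr0 // => [p' /negPf pp|q' /negPf qq|i' /negPf ii|j' /negPf jj].
- rewrite big1 // => q' _; rewrite ipE big1 // => i' _; rewrite big1 // => j' _.
  by rewrite !mxE pp mul0r mulr0.
- rewrite ipE big1 // => i' _; rewrite big1 // => j' _.
  by rewrite !mxE qq mulr0 mulr0.
- by rewrite big1 // => j' _; rewrite !mxE ii andbF mul0r mulr0.
- by rewrite !mxE jj andbF mulr0 mulr0.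
Qed.

Lemma dual_norm_set_bounded k (u : 'M[E]_k) :
  has_ubound [set normc (pairing W u) | W in [set W : 'M[E]_k | contractive W]].
Proof.
exists (\sum_p \sum_q \sum_i \sum_j normc (u p q i j)) => _ [W /= Wc <-].
apply: le_trans (normc_sum _ _ _) _; apply: ler_sum => p _.
apply: le_trans (normc_sum _ _ _) _; apply: ler_sum => q _; rewrite ipE.
apply: le_trans (normc_sum _ _ _) _; apply: ler_sum => i _.
apply: le_trans (normc_sum _ _ _) _; apply: ler_sum => j _.
by rewrite Normc.normcM ler_piMl ?normc_ge0 // contractive_entry.
Qed.

Lemma le_dual_norm k (W u : 'M[E]_k) :
  contractive W -> normc (pairing W u) <= dual_norm u.
Proof. by move=> Wc; apply: (ub_le_sup (dual_norm_set_bounded u)); exists W. Qed.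

Lemma dual_norm_le k (u : 'M[E]_k) c :
  (forall W, contractive W -> normc (pairing W u) <= c) -> dual_norm u <= c.
Proof.
move=> uc; apply: ge_sup => [|_ [W Wc <-]]; last exact: uc.
by exists (normc (pairing 0 u)), 0 => //=; apply: contractive0.
Qed.

Lemma dual_norm_ge0 k (u : 'M[E]_k) : 0 <= dual_norm u.
Proof. exact: le_trans (normc_ge0 _) (le_dual_norm u (contractive0 (k := k))). Qed.

Lemma pairingDr k (W u w : 'M[E]_k) :
  pairing W (u + w) = pairing W u + pairing W w.
Proof.
rewrite /pairing -big_split; apply: eq_bigr => p _; rewrite -big_split.
by apply: eq_bigr => q _; rewrite mxE ipDr.
Qed.

Lemma pairingZr k c (W u : 'M[E]_k) :
  pairing W (map_mx ( *:%R c) u) = c * pairing W u.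
Proof.
rewrite /pairing mulr_sumr; apply: eq_bigr => p _; rewrite mulr_sumr.
by apply: eq_bigr => q _; rewrite mxE ipZr.
Qed.

Lemma pairingZl k c (W u : 'M[E]_k) :
  pairing (map_mx ( *:%R c) W) u = c * pairing W u.
Proof.
rewrite /pairing mulr_sumr; apply: eq_bigr => p _; rewrite mulr_sumr.
by apply: eq_bigr => q _; rewrite mxE ipZl.
Qed.

(** By homogeneity: [W] divided by c would be contractive. Dividing by c + d with a small d > 0 also
    covers c = 0. *)
Lemma pairing_le k c (W u : 'M[E]_k) : 0 <= c ->
    (forall y x, normc (pairing W (tens y x)) <= c * (frob y * frob x)) ->
  normc (pairing W u) <= c * dual_norm u.
Proof.
move=> c0 Wc; apply/ler_addgt0Pr => e e0.
(* Chosen so that [d * dual_norm u <= e]; the added 1 keeps the denominator positive. *)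
pose d := e / (dual_norm u + 1).
have N1 : 0 < dual_norm u + 1 by rewrite ltr_wpDl ?dual_norm_ge0.
have d0 : 0 < d by rewrite divr_gt0.
have cd : 0 < c + d by rewrite ltr_wpDl.
have inv : normc ((c + d)^-1)%:C = (c + d)^-1.
  by rewrite normc_real // invr_ge0 ltW.
have : normc (pairing (map_mx ( *:%R ((c + d)^-1)%:C) W) u) <= dual_norm u.
  apply: le_dual_norm => y x; rewrite pairingZl Normc.normcM inv.
  rewrite ler_pdivrMl // (le_trans (Wc _ _)) // ler_wpM2r //.
    by rewrite mulr_ge0 ?l2_ge0.
  by rewrite lerDl ltW.
rewrite pairingZl Normc.normcM inv ler_pdivrMl // => /le_trans -> //.
rewrite mulrDl lerD2l /d mulrAC ler_pdivrMr // ler_wpM2l ?ltW //.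
by rewrite ltrDl ltr01.
Qed.

(** * The axioms of a matrix-norm for the dual norm *)

Lemma dual_norm_triangle k (u w : 'M[E]_k) :
  dual_norm (u + w) <= dual_norm u + dual_norm w.
Proof.
apply: dual_norm_le => W Wc; rewrite pairingDr.
by apply: le_trans (normcD _ _) _; rewrite lerD ?le_dual_norm.
Qed.

Lemma dual_norm_scale_le k c (u : 'M[E]_k) :
  dual_norm (map_mx ( *:%R c) u) <= normc c * dual_norm u.
Proof.
apply: dual_norm_le => W Wc; rewrite pairingZr Normc.normcM.
by rewrite ler_wpM2l ?normc_ge0 ?le_dual_norm.
Qed.

Lemma dual_norm_scale k c (u : 'M[E]_k) :
  dual_norm (map_mx ( *:%R c) u) = normc c * dual_norm u.
Proof.
apply/le_anti; rewrite dual_norm_scale_le /=.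
have [->|c0] := eqVneq c 0; first by rewrite Normc.normc0 mul0r dual_norm_ge0.
have nc : 0 < normc c.
  rewrite lt_def normc_ge0 andbT; apply: contra_neq c0.
  exact: Normc.eq0_normc.
(* The reverse inequality is the one already proved, for the scalar c^-1 and the matrix c u. *)
rewrite -ler_pdivlMl // -Normc.normcV.
apply: le_trans (dual_norm_scale_le _ _); rewrite -map_mx_comp.
rewrite (_ : map_mx _ u = u) //; apply/matrixP => p q.
by rewrite mxE /= scalerA mulVf // scale1r.
Qed.

Lemma frob_entry k (y : 'M[C]_(k, n)) p i : normc (y p i) <= frob y.
Proof. exact: (normc_le_l2 (fun s : 'I_k * 'I_n => y s.1 s.2) (p, i)). Qed.

(** A matrix unit [W] of M_kn is contractive and its pairing reads off a single scalar entry. *)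
Lemma dual_norm_eq0 k (u : 'M[E]_k) : dual_norm u = 0 -> u = 0.
Proof.
move=> u0; apply/matrixP => p q; apply/matrixP => i j.
pose W : 'M[E]_k := \matrix_(p', q') \matrix_(i', j')
  ((p' == p)%:R * (q' == q)%:R * (i' == i)%:R * (j' == j)%:R).
have WE w : pairing W w = w p q i j.
  rewrite /pairing (bigD1 p) //= (bigD1 q) //= ipE (bigD1 i) //= (bigD1 j) //=.
  rewrite !mxE !eqxx !mul1r.
  rewrite !big1 ?addr0 // => [p' /negPf pp|q' /negPf qq|i' /negPf ii|j' /negPf jj].
  - rewrite big1 // => q' _; rewrite ipE big1 // => i' _; rewrite big1 // => j' _.
    by rewrite !mxE pp !mul0r.
  - rewrite ipE big1 // => i' _; rewrite big1 // => j' _.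
    by rewrite !mxE qq !(mulr0, mul0r).
  - by rewrite big1 // => j' _; rewrite !mxE ii !(mulr0, mul0r).
  - by rewrite !mxE jj !(mulr0, mul0r).
have Wc : contractive W.
  move=> y x; rewrite WE !mxE Normc.normcM.
  by rewrite ler_pM ?normc_ge0 ?frob_entry.
rewrite [in RHS]mxE [RHS]mxE; apply: Normc.eq0_normc; apply/le_anti.
by rewrite normc_ge0 andbT -WE -u0 le_dual_norm.
Qed.

Lemma dual_norm_block0 k l (u : 'M[E]_k) :
  dual_norm (block_mx u 0 0 (0 : 'M[E]_l)) = dual_norm u.
Proof.
apply/le_anti/andP; split; apply: dual_norm_le => W Wc.
  by rewrite pairing_block0 le_dual_norm //; apply: contractive_ulsub.
have -> : pairing W u = pairing (block_mx W 0 0 0) (block_mx u 0 0 (0 : 'M[E]_l)).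
  by rewrite pairing_block0 block_mxKul.
by rewrite le_dual_norm //; apply: contractive_block0.
Qed.

(** [S] crosses the pairing to [W]; on rank one operators it then acts on the vector [y] alone, at
    the cost of a factor [opnorm S]. *)
Lemma dual_norm_lmul k S (u : 'M[E]_k) :
  dual_norm (lmulmx S u) <= opnorm S * dual_norm u.
Proof.
apply: dual_norm_le => W Wc; rewrite pairing_lmul.
apply: pairing_le; first exact: opnorm_ge0.
move=> y x; rewrite -pairing_lmul lmul_tens (le_trans (Wc _ _)) //.
by rewrite mulrA ler_wpM2r ?l2_ge0 ?frob_mul.
Qed.

Lemma dual_norm_rmul k (u : 'M[E]_k) S :
  dual_norm (rmulmx u S) <= dual_norm u * opnorm S.
Proof.
apply: dual_norm_le => W Wc; rewrite pairing_rmul mulrC.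
apply: pairing_le; first exact: opnorm_ge0.
move=> y x; rewrite -pairing_rmul rmul_tens (le_trans (Wc _ _)) //.
by rewrite mulrCA ler_wpM2l ?l2_ge0 ?frob_mul_tr.
Qed.

Definition dual_norm_space : matNormedSpace R :=
  @MatNormedSpace R E dual_norm dual_norm_triangle dual_norm_scale
    dual_norm_eq0 dual_norm_block0 dual_norm_lmul dual_norm_rmul.

Lemma dual_norm_tens k (y x : 'M[C]_(k, n)) :
  dual_norm (tens y x) <= frob y * frob x.
Proof. by apply: dual_norm_le => W; apply. Qed.

(** The test matrix is block-diagonal with the polar contractions [V p] as blocks. The transposes in
    the statement cancel the one in [ip], leaving the traces of [V p *m u p = absmx (u p)]. *)
Lemma dual_norm_diag k (u : 'I_k -> E) :
  \sum_p trnorm (u p) <= dual_norm (diag_mx (\row_p (u p)^T)).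
Proof.
have [V VE Vc] := fin_all_exists2 (fun p => polar_contraction (u p)).
pose W : 'M[E]_k := diag_mx (\row_p V p).
have WE w : pairing W w = \sum_p ip (V p) (w p p).
  apply: eq_bigr => p _; rewrite (bigD1 p) //= !mxE eqxx mulr1n.
  rewrite big1 ?addr0 // => q; rewrite eq_sym => /negPf pq.
  by rewrite !mxE pq mulr0n ip0l.
apply: (@le_trans _ _ (normc (pairing W (diag_mx (\row_p (u p)^T))))).
  apply: le_trans (Re_le_normc _); rewrite WE raddf_sum ler_sum // => p _.
  by rewrite !mxE eqxx mulr1n /ip trmxK VE.
apply: le_dual_norm => y x; rewrite WE.
apply: le_trans (normc_sum _ _ _) _.
apply: (@le_trans _ _ (\sum_p l2 (y p) * l2 (x p))).
  apply: ler_sum => p _; apply: le_trans (Vc p _ _).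
  rewrite ipE le_eqVlt; apply/orP; left; apply/eqP; congr normc.
  by apply: eq_bigr => i _; apply: eq_bigr => j _; rewrite !mxE.
(* Cauchy-Schwarz over the blocks, as [frob] squared is the sum of the squared row norms. *)
rewrite -(@ler_pXn2r _ 2) ?nnegrE ?mulr_ge0 ?l2_ge0 //.
  by rewrite exprMn !frob_row sqr_sum_mul_le.
by apply: sumr_ge0 => p _; rewrite mulr_ge0 ?l2_ge0.
Qed.

End DualTraceNorm.

(** * A bound on amplifications that is uniform in the space and in [v] *)

Section HatNormBound.
Variables (R : realType) (E : matNormedSpace R).
Local Notation C := R[i].
Local Notation normc := (@Normc.normc R).

Lemma mnorm0 k : mnorm (0 : 'M[E]_k) = 0.
Proof.
rewrite -[RHS](mul0r (mnorm (0 : 'M[E]_k))) -(Normc.normc0 R) -mnorm_scale.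
by congr mnorm; apply/matrixP => p q; rewrite !mxE scale0r.
Qed.

(** Nonnegativity follows from 0 = [mnorm (u - u)] <= 2 [mnorm u]. *)
Lemma mnorm_ge0 k (u : 'M[E]_k) : 0 <= mnorm u.
Proof.
have uN : mnorm (- u) = mnorm u.
  rewrite -[RHS]mul1r -(Normc.normc1 R) -(normcN (1 : C)) -mnorm_scale.
  by congr mnorm; apply/matrixP => p q; rewrite !mxE scaleN1r.
have := mnorm_triangle u (- u).
by rewrite subrr mnorm0 uN -mulr2n pmulrn_lge0.
Qed.

Lemma mnorm_sum (I : finType) k (F : I -> 'M[E]_k) :
  mnorm (\sum_i F i) <= \sum_i mnorm (F i).
Proof.
elim/big_rec2: _ => [|i a b _ IH]; first by rewrite mnorm0.
by apply: le_trans (mnorm_triangle _ _) _; rewrite lerD2l.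
Qed.

Definition unit_mx k (p q : 'I_k) (x : E) : 'M[E]_k :=
  \matrix_(i, j) if (i == p) && (j == q) then x else 0.

Lemma unit_mx_id k (p q : 'I_k) x : unit_mx p q x p q = x.
Proof. by rewrite mxE !eqxx. Qed.

Lemma lmulmx_delta k (p r : 'I_k) (u : 'M[E]_k) :
  lmulmx (delta_mx p r) u = \matrix_(i, j) if i == p then u r j else 0.
Proof.
apply/matrixP => i j; rewrite !mxE (bigD1 r) //= big1 => [|s /negPf sr].
  by rewrite mxE eqxx andbT addr0; case: eqP => _; rewrite ?scale1r ?scale0r.
by rewrite mxE sr andbF scale0r.
Qed.

Lemma rmulmx_delta k (r q : 'I_k) (u : 'M[E]_k) :
  rmulmx u (delta_mx r q) = \matrix_(i, j) if j == q then u i r else 0.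
Proof.
apply/matrixP => i j; rewrite !mxE (bigD1 r) //= big1 => [|s /negPf sr].
  by rewrite mxE eqxx addr0; case: eqP => _; rewrite ?scale1r ?scale0r.
by rewrite mxE sr scale0r.
Qed.

Lemma mnorm_move_entry k (u : 'M[E]_k) (p q p' q' : 'I_k) :
  mnorm (unit_mx p' q' (u p q)) <= mnorm u.
Proof.
have -> : unit_mx p' q' (u p q) =
    lmulmx (delta_mx p' p) (rmulmx u (delta_mx q q')).
  rewrite lmulmx_delta rmulmx_delta; apply/matrixP => i j; rewrite !mxE.
  by case: (i == p').
apply: le_trans (mnorm_lmul _ _) _.
apply: (@le_trans _ _ (mnorm (rmulmx u (delta_mx q q')))).
  by rewrite ler_piMl ?mnorm_ge0 ?opnorm_delta.
by apply: le_trans (mnorm_rmul _ _) _; rewrite ler_piMr ?mnorm_ge0 ?opnorm_delta.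
Qed.

Lemma unit_mx_lshift0 k (x : E) :
  unit_mx (lshift k ord0) (lshift k ord0) x = block_mx (const_mx x : 'M_1) 0 0 (0 : 'M_k).
Proof.
apply/matrixP => i j; rewrite [LHS]mxE.
case: (split_ordP i) => i' ->; case: (split_ordP j) => j' ->;
  rewrite ?(block_mxEul, block_mxEur, block_mxEdl, block_mxEdr) ?ord1 ?mxE ?eqxx //.
all: by rewrite ?[rshift _ _ == _]eq_sym ?eq_lrshift ?andbF.
Qed.

(** Matrix units carry [v i j] to the top-left corner, Axiom 1 passes from size n to size m through
    a common 1 x 1 block, and matrix units carry the entry on to (p, q). *)
Lemma mnorm_unit_entry n m (v : 'M[E]_n) i j (p q : 'I_m) :
  mnorm (unit_mx p q (v i j)) <= mnorm v.
Proof.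
(* The indices exclude empty sizes, and a successor is read as [1 + n] to fit [block_mx]. *)
case: n v i j => [|n] v i j; first by case: i.
case: m p q => [|m] p q; first by case: p.
apply: (@le_trans _ _ (mnorm (unit_mx (lshift n (ord0 : 'I_1)) (lshift n ord0) (v i j))));
  last exact: (@mnorm_move_entry (1 + n) v i j _ _).
have -> : mnorm (unit_mx (lshift n (ord0 : 'I_1)) (lshift n ord0) (v i j)) =
    mnorm (unit_mx (lshift m (ord0 : 'I_1)) (lshift m ord0) (v i j)).
  by rewrite !unit_mx_lshift0 (mnorm_block0 n) (mnorm_block0 m).
have := mnorm_move_entry (unit_mx (lshift m (ord0 : 'I_1)) (lshift m ord0) (v i j))
  (lshift m (ord0 : 'I_1)) (lshift m ord0) p q.
by rewrite unit_mx_id.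
Qed.

(** The amplification is a combination of one-entry matrices of norm at most 1. The bound involves
    [u] alone, so the supremum over all [E] and [v] is finite. *)
Lemma mnorm_amplification_le n m (v : 'M[E]_n) (u : 'M['M[C]_n]_m) :
  mnorm v <= 1 ->
  mnorm (amplification (phi v) u) <=
    \sum_p \sum_q \sum_i \sum_j normc (u p q j i).
Proof.
move=> v1.
have -> : amplification (phi v) u =
    \sum_p \sum_q \sum_i \sum_j map_mx ( *:%R (u p q j i)) (unit_mx p q (v i j)).
  apply/matrixP => p q; rewrite mxE summxE (bigD1 p) //= summxE (bigD1 q) //=.
  rewrite [X in _ = _ + X]big1 => [|p' /negPf pp]; last first.
    rewrite summxE big1 // => q' _; rewrite summxE big1 // => i _.
    by rewrite summxE big1 // => j _; rewrite !mxE eq_sym pp scaler0.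
  rewrite [X in _ = _ + X + _]big1 => [|q' /negPf qq]; last first.
    rewrite summxE big1 // => i _; rewrite summxE big1 // => j _.
    by rewrite !mxE [q == _]eq_sym qq andbF scaler0.
  rewrite !addr0 summxE; apply: eq_bigr => i _; rewrite summxE.
  by apply: eq_bigr => j _; rewrite !mxE !eqxx.
apply: le_trans (mnorm_sum _) _; apply: ler_sum => p _.
apply: le_trans (mnorm_sum _) _; apply: ler_sum => q _.
apply: le_trans (mnorm_sum _) _; apply: ler_sum => i _.
apply: le_trans (mnorm_sum _) _; apply: ler_sum => j _.
rewrite mnorm_scale ler_piMr ?normc_ge0 //.
exact: le_trans (mnorm_unit_entry _ _ _ _ _) v1.
Qed.

End HatNormBound.

(** * The lower bound on the norm of block-diagonal matrices *)

Lemma le_hatnorm (R : realType) n m (u : 'M['M[R[i]]_n]_m)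
    (E : matNormedSpace R) (v : 'M[E]_n) :
  mnorm v <= 1 -> mnorm (amplification (phi v) u) <= hatnorm u.
Proof.
move=> v1; apply: ub_le_sup; last by exists E, v.
eexists=> _ [F [w [w1 ->]]]; exact: mnorm_amplification_le.
Qed.

Theorem proposition13 (R : realType) (n m : nat) (n_gt0 : (0 < n)%N)
    (m_gt0 : (0 < m)%N) (a : 'I_m -> 'M[R[i]]_n) :
  hatnorm (diag_mx (\row_(k < m) a k)) >= n%:R^-1 * \sum_(k < m) trnorm (a k).
Proof.
pose c : R[i] := (n%:R^-1)%:C.
have cE : Normc.normc c = n%:R^-1 by rewrite normc_real // invr_ge0 ler0n.
(* The (p, q) entry of [tens 1%:M 1%:M] is the matrix unit e_pq. *)
pose v : 'M[dual_norm_space R n]_n := map_mx ( *:%R c) (tens 1%:M 1%:M).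
have v1 : mnorm v <= 1.
  rewrite mnorm_scale cE ler_pdivrMl ?ltr0n // mulr1.
  (* The identity, as a vector of C^n (x) C^n, has squared norm n, which the factor 1/n offsets. *)
  by apply: le_trans (dual_norm_tens _ _) _; rewrite -expr2 frob1.
apply: le_trans (le_hatnorm _ v1).
have -> : amplification (phi v) (diag_mx (\row_(k < m) a k)) =
    map_mx ( *:%R c) (diag_mx (\row_k (a k)^T) : 'M[dual_norm_space R n]_m).
  apply/matrixP => p q; rewrite !mxE.
  (* Only the term of e_ij reaches position (i, j), and [phi] gives it the coefficient of index (j,
     i): hence the transpose. *)
  apply/matrixP => i j; rewrite /phi summxE (bigD1 i) //= summxE (bigD1 j) //=.
  rewrite [X in _ + X]big1 => [|i' /negPf ii]; last first.
    rewrite summxE big1 // => j' _.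
    by rewrite !mxE ii mul0r !mulr0.
  rewrite [X in _ + X + _]big1 => [|j' /negPf jj]; last first.
    by rewrite !mxE jj !mulr0.
  rewrite !addr0 !mxE !eqxx !mulr1; case: (p == q).
    by rewrite !mulr1n mxE mulrC.
  by rewrite !mulr0n !mxE mulr0 mul0r.
rewrite mnorm_scale cE ler_wpM2l ?invr_ge0 ?ler0n //.
exact: dual_norm_diag.
Qed.
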